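(* Let $\|\cdot\|$ be an algebra norm (a submultiplicative norm with $\|I\|=1$) on a unital $C^*$-algebra $\mathscr{A}$. If $\|\cdot\|$, regarded as a map $\mathscr{A}\to\mathbb{C}$, is $3$-positive, then $$\|XY\|=\|X\|\,\|Y\|$$ for every $X,Y\in\mathscr{A}$.
   Context: A (not necessarily linear) map $\Phi:\mathscr{A}\to\mathscr{B}$ between $C^*$-algebras is $n$-positive if the entrywise map $\Phi_n:M_n(\mathscr{A})\to M_n(\mathscr{B})$, $\Phi_n([a_{ij}])=[\Phi(a_{ij})]$, sends positive elements to positive elements. Here $\mathscr{B}=\mathbb{C}$, so $3$-positivity of $\|\cdot\|$ means that $[\|a_{ij}\|]\in M_3(\mathbb{C})$ is positive semidefinite whenever $[a_{ij}]\in M_3(\mathscr{A})$ is positive. *)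

(* Defs.v *)
From HB Require Import structures.
From mathcomp Require Import all_boot all_order all_algebra.
From mathcomp Require Import complex.
From mathcomp Require Import all_classical all_reals all_analysis.

Set Implicit Arguments.
Unset Strict Implicit.
Unset Printing Implicit Defensive.

Import Order.TTheory GRing.Theory Num.Theory.
Import numFieldNormedType.Exports.

Local Open Scope ring_scope.
Local Open Scope sesquilinear_scope.
Local Open Scope classical_set_scope.

Record algebra_norm (R : realType) (A : algType R[i]) (N : A -> R) : Prop :=
  AlgebraNorm {
    algebra_norm_eq0 : forall x, N x = 0 -> x = 0;
    algebra_norm_triangle : forall x y, N (x + y) <= N x + N y;
    algebra_normZ : forall (a : R[i]) x, (N (a *: x))%:C%C = `|a| * (N x)%:C%C;
    algebra_normM_le : forall x y, N (x * y) <= N x * N y;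
    algebra_norm1 : N 1 = 1
  }.

(* The norm is a field cnorm rather than an inherited library norm: the
   hierarchy has no join of NormedModule and Algebra, and HB refuses to add one
   after NumDomain.  cnorm 1 = 1 is not an extra requirement, as it follows
   from the C*-identity and 1 != 0 (algType extends nzRingType). *)
HB.mixin Record isCStarAlgebra (R : realType) A & GRing.Algebra R[i] A := {
  star : A -> A;
  cnorm : A -> R;
  starK : involutive star;
  starD : {morph star : x y / x + y};
  starZ : forall (a : R[i]) x, star (a *: x) = a^* *: star x;
  starM : forall x y, star (x * y) = star y * star x;
  cnorm_algebra_norm : algebra_norm cnorm;
  cnorm_starM : forall x, cnorm (star x * x) = cnorm x ^+ 2;
  cnorm_complete : forall u : nat -> A,
    (forall e : R, 0 < e -> \forall m & n \near \oo, cnorm (u m - u n) < e) ->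
    exists l : A, (fun n => cnorm (u n - l)) @ \oo --> (0 : R)
}.

#[short(type="cstarAlgType")]
HB.structure Definition CStarAlgebra (R : realType) :=
  {A of GRing.Algebra R[i] A & isCStarAlgebra R A}.

(* Positivity in the C*-algebra M_n(A), whose involution is the conjugate
   transpose M ^t star: the positive elements of a C*-algebra are those of the
   form b^* b. *)
Definition mx_positive (R : realType) (A : cstarAlgType R) (n : nat)
    (M : 'M[A]_n) : Prop :=
  exists B : 'M[A]_n, M = B ^t (@star R A) *m B.

(* 0 <= z in R[i] means that z is real and nonnegative. *)
Definition psdmx (R : realType) (n : nat) (M : 'M[R[i]]_n) : Prop :=
  M ^t* = M /\ forall v : 'cV[R[i]]_n, 0 <= (v ^t* *m M *m v) 0 0.

Definition n_positive (R : realType) (A : cstarAlgType R) (n : nat)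
    (Phi : A -> R[i]) : Prop :=
  forall M : 'M[A]_n, mx_positive M -> psdmx (map_mx Phi M).

(* Main.v *)
Require Import Defs.
From mathcomp Require Import all_boot all_order all_algebra.
From mathcomp Require Import complex.
From mathcomp Require Import all_classical all_reals all_analysis.
From mathcomp Require Import lra.

(** The norm [N] is applied to the Gram matrix [b_i^* b_j] of the triple
    [b = (1, X^*, Y)], which is positive in [M_3(A)].  By 3-positivity the real
    matrix
<<
      1       N(X)       N(Y)
      N(X)    N(X X^* )  N(X Y)
      N(Y)    N(X Y)     N(Y^* Y)
>>
    is positive semidefinite; its symmetry gives [N(X^* ) = N(X)].  By
    submultiplicativity the diagonal entries [N(X X^* )] and [N(Y^* Y)] are at
    most [N(X)^2] and [N(Y)^2].  The quadratic form evaluated at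
    [(- (N(X) + N(Y)), 1, 1)] is therefore at most [2 (N(XY) - N(X) N(Y))], so
    positivity yields [N(X) N(Y) <= N(X Y)], the reverse of
    submultiplicativity. *)

Set Implicit Arguments.
Unset Strict Implicit.
Unset Printing Implicit Defensive.

Import Order.TTheory GRing.Theory Num.Theory.

Local Open Scope ring_scope.
Local Open Scope sesquilinear_scope.

Section Star.
Variables (R : realType) (A : cstarAlgType R).

Lemma star0 : star (0 : A) = 0.
Proof. by apply: (addrI (star (0 : A))); rewrite -starD !addr0. Qed.

Lemma star1 : star (1 : A) = 1.
Proof. by rewrite -[LHS]mulr1 -[X in _ * X]starK -starM mulr1 starK. Qed.

(** The Gram matrix is [B^* B] for the square matrix [B] whose only nonzero row
    is [b]. *)
Lemma mx_positive_gram n (b : 'I_n.+1 -> A) :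
  mx_positive (\matrix_(i, j) (star (b i) * b j)).
Proof.
exists (\matrix_(i, j) if i == 0 then b j else 0).
apply/matrixP => i j; rewrite !mxE (bigD1 ord0) //= !mxE eqxx.
by rewrite big1 ?addr0 // => k /negPf k0; rewrite !mxE k0 star0 mul0r.
Qed.

Lemma n_positive_gram_sym n (N : A -> R) (b : 'I_n.+1 -> A) i j :
  n_positive n.+1 (fun x : A => (N x)%:C%C) ->
  N (star (b i) * b j) = N (star (b j) * b i).
Proof.
move=> /(_ _ (mx_positive_gram b)) [/matrixP/(_ j i) + _].
by rewrite !mxE [_^*]conjc_real => /complexI.
Qed.

(** Real vectors suffice to test positivity here, since the values of [N] are
    real; this turns the complex form into an inequality in [R]. *)
Lemma n_positive_gram_form_ge0 n (N : A -> R) (b : 'I_n.+1 -> A)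
    (c : 'I_n.+1 -> R) :
  n_positive n.+1 (fun x : A => (N x)%:C%C) ->
  0 <= \sum_j (\sum_i c i * N (star (b i) * b j)) * c j.
Proof.
move=> /(_ _ (mx_positive_gram b)) [_ /(_ (\col_i (c i)%:C%C))].
rewrite -[0 <= \sum_j _]lecR rmorph0 rmorph_sum mxE.
congr (_ <= _); apply: eq_bigr => j _; rewrite !mxE rmorphM rmorph_sum /=.
congr (_ * _); apply: eq_bigr => i _; rewrite !mxE rmorphM /=.
by rewrite [_^*]conjc_real.
Qed.

End Star.

(** The default value of [nth] is the entry of index 2. *)
Definition triple (T : Type) (x y z : T) (i : 'I_3) : T := nth z [:: x; y] i.

(** [X] and [X^* ] are the opposite corner entries of the Gram matrix of
    [(1, 1, X)]. *)
Lemma n_positive_star (R : realType) (A : cstarAlgType R) (N : A -> R) :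
  n_positive 3 (fun x : A => (N x)%:C%C) -> forall X, N (star X) = N X.
Proof.
move=> Npos X.
have := n_positive_gram_sym (triple 1 1 X) ord_max ord0 Npos.
by rewrite /triple /= mulr1 star1 mul1r.
Qed.

Theorem corollary3p3 (R : realType) (A : cstarAlgType R) (N : A -> R)
    (N_norm : algebra_norm N)
    (N_3pos : n_positive 3 (fun x : A => (N x)%:C%C)) :
  forall X Y : A, N (X * Y) = N X * N Y.
Proof.
move=> X Y; apply/eqP; rewrite eq_le algebra_normM_le //=.
have Nstar := n_positive_star N_3pos.
have := algebra_normM_le N_norm X (star X).
have := algebra_normM_le N_norm (star Y) Y.
(* The coefficient [- (N X + N Y)] minimizes the quadratic form over its first
   coordinate, the other two being 1, when the first row is
   [(1, N X, N Y)]. *)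
have := n_positive_gram_form_ge0 (triple 1 (star X) Y)
  (triple (- (N X + N Y)) 1 1) N_3pos.
rewrite !big_ord_recl !big_ord0 /triple /= !starK star1 !mul1r !mulr1.
rewrite (algebra_norm1 N_norm) -(Nstar (star Y * star X)) starM !starK !Nstar.
nra.
Qed.
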